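(* There exists an absolute constant $C$ such that for every $n\ge 1$ and every $p$ with $0\le p\le 1-\frac{10^5}{n}$, if $G\sim G(n,p)$ then $$\mathbb{P}(G\text{ is even-non-decomposable})\le \frac{C}{n^2}.$$
   Context: $G(n,p)$ is the binomial random graph on $n$ labelled vertices in which each pair is an edge independently with probability $p$. A graph $H$ is even-decomposable if there is a sequence $V(H)=V_0\supset V_1\supset\cdots\supset V_k=\emptyset$ such that for each $0\le i\le k-1$, the induced subgraph $H[V_i]$ has an even number of edges and $V_i\setminus V_{i+1}$ is an independent set in $H$. A graph is even-non-decomposable if it has an even number of edges but is not even-decomposable. *)

(* Defs.v *)
From HB Require Import structures.
From mathcomp Require Import all_boot all_order all_algebra.
From mathcomp Require Import boolp reals.
Set Implicit Arguments. Unset Strict Implicit. Unset Printing Implicit Defensive.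
Import Order.TTheory GRing.Theory Num.Theory.

Definition pairs (n : nat) : {set {set 'I_n}} := [set e : {set 'I_n} | #|e| == 2].

Definition is_graph n (E : {set {set 'I_n}}) : bool := E \subset pairs n.

Definition induced n (E : {set {set 'I_n}}) (V : {set 'I_n}) : {set {set 'I_n}} :=
  [set e in E | e \subset V].

Definition independent n (E : {set {set 'I_n}}) (S : {set 'I_n}) : bool :=
  [forall e in E, ~~ (e \subset S)].

Definition even_decomposable n (E : {set {set 'I_n}}) : Prop :=
  exists (k : nat) (V : nat -> {set 'I_n}),
    [/\ V 0%N = setT, V k = set0 &
        forall i, (i < k)%N ->
          [/\ V i.+1 \proper V i,
              ~~ odd #|induced E (V i)| &
              independent E (V i :\: V i.+1)]].

Definition even_non_decomposable n (E : {set {set 'I_n}}) : Prop :=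
  ~~ odd #|E| /\ ~ even_decomposable E.

Local Open Scope ring_scope.

Definition gnp_prob (R : realType) (n : nat) (p : R)
    (P : {set {set 'I_n}} -> Prop) : R :=
  \sum_(E : {set {set 'I_n}} | is_graph E && `[< P E >])
     p ^+ #|E| * (1 - p) ^+ (#|pairs n| - #|E|)%N.

(* Main.v *)
Require Import Defs.
From HB Require Import structures.
From mathcomp Require Import all_boot all_order all_algebra.
From mathcomp Require Import boolp reals.
From mathcomp Require Import zify lra.
Set Implicit Arguments. Unset Strict Implicit. Unset Printing Implicit Defensive.
Import Order.TTheory GRing.Theory Num.Theory.

(** A decomposition is built from the empty set upwards: a decomposable set [A]
may be enlarged by an outside vertex with an even number of neighbours in [A],
or by two nonadjacent outside vertices with odd numbers of neighbours in [A].
When neither is possible the outside vertices form a clique.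

The key fact is a finite one.  If three outside vertices form a clique and are
all odd to [A], and [S] is an induced path on four vertices outside [A], then
all but at most two of these seven vertices can be added to [A], whatever the
remaining adjacencies and parities are.  So every disjoint induced P4 lowers the
number of left-over vertices by one, until at most two are left; those are
handled by the parity of the total number of edges.

A graph without induced P4 is a cograph, so any [4 m] vertices contain an
induced P4 or else there are disjoint [X], [Y] of size at least [m] with all or
none of the edges between them.  If there is no such pair in the graph, P4's can
be taken greedily and [20 m <= n] suffices for decomposability.  For
[10^5 / n <= p <= 1 - 10^5 / n] and [m = n / 20] a union bound over the pairs
shows that a bad pair is exponentially unlikely.  For [p <= 10^5 / n] it is
enough that even K4-free graphs are decomposable, because the expected number
of K4's is at most [n^4 p^6]. *)

(** * Decomposable sets *)

Section Decomposition.
Variables (n : nat) (E : {set {set 'I_n}}).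
Hypothesis graphE : is_graph E.
Implicit Types (A B U R : {set 'I_n}) (u v : 'I_n).

Definition adj u v := [set u; v] \in E.

Lemma adjC u v : adj u v = adj v u.
Proof. by rewrite /adj setUC. Qed.

Lemma card_edge e : e \in E -> #|e| = 2.
Proof. by move/(subsetP graphE); rewrite inE => /eqP. Qed.

Lemma adjxx u : adj u u = false.
Proof. by apply/negP => /card_edge; rewrite setUid cards1. Qed.

Definition par A v : bool := odd #|[set u in A | adj u v]|.

Lemma parU1 A u v : u \notin A -> par (u |: A) v = par A v (+) adj u v.
Proof.
move=> uA; rewrite /par; case auv: (adj u v).
  have -> : [set w in u |: A | adj w v] = u |: [set w in A | adj w v].
    by apply/setP=> w; rewrite !inE; case: eqP => [->|//]; rewrite auv.
  by rewrite cardsU1 inE (negbTE uA) /= addbT.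
rewrite addbF; congr (odd #|pred_of_set _|).
by apply/setP=> w; rewrite !inE; case: eqP => [->|//]; rewrite auv (negbTE uA).
Qed.

(** The edges gained are those through [v], and [u] to [[set u; v]] matches them with the neighbours
    of [v] in [A]. *)
Lemma odd_inducedU1 A v : v \notin A ->
  odd #|induced E (v |: A)| = odd #|induced E A| (+) par A v.
Proof.
move=> vA; rewrite /par -oddD.
have -> : #|[set u in A | adj u v]| =
          #|[set [set u; v] | u in [set u in A | adj u v]]|.
  rewrite card_in_imset // => x y; rewrite !inE => /andP[xA _] _ xy.
  have: x \in [set y; v] by rewrite -xy set21.
  by rewrite !inE => /orP[/eqP//|/eqP xv]; rewrite -xv xA in vA.
congr odd; rewrite -cardsUI [X in _ = _ + X]eq_card0 ?addn0; last first.
  move=> e; rewrite !inE; apply/negP => /andP[/andP[_ eA] /imsetP[u _ eE]].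
  by move/subsetP/(_ v): eA; rewrite eE set22 => /(_ isT); rewrite (negbTE vA).
apply: eq_card => e; rewrite !inE; apply/andP/orP => [[eE sub]|].
  case: (boolP (v \in e)) => ve; last first.
    left; rewrite eE /=; apply/subsetP=> x xe.
    move/subsetP/(_ x xe): sub; rewrite !inE => /orP[/eqP xv|//].
    by rewrite -xv xe in ve.
  right; have /cards2P[x [y [xy eE2]]] : #|e| == 2 by rewrite card_edge.
  wlog vy : x y xy eE2 / v = y => [W|].
    have: v \in [set x; y] by rewrite -eE2.
    rewrite !inE => /orP[]/eqP; last exact: (W x y).
    by apply: (W y x); rewrite 1?eq_sym // setUC.
  subst y; apply/imsetP; exists x => //; rewrite !inE /adj -eE2 eE andbT.
  move/subsetP/(_ x): sub; rewrite eE2 set21 => /(_ isT).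
  by rewrite !inE (negbTE xy).
case=> [/andP[-> sub]|/imsetP[u uP ->]].
  by split=> //; apply: subset_trans sub (subsetUr _ _).
move: uP; rewrite inE => /andP[uA uv]; split=> //.
by rewrite subUset !sub1set !inE eqxx uA orbT.
Qed.

Lemma induced0 : induced E set0 = set0.
Proof.
apply/setP=> e; rewrite !inE subset0; apply/negP => /andP[/card_edge + /eqP e0].
by rewrite e0 cards0.
Qed.

(** The chain of [even_decomposable] read from its empty end, so that proofs can grow a set step by
    step. Nonempty [S] disjoint from [A] makes each inclusion proper. *)
Inductive dec : {set 'I_n} -> Prop :=
| dec_empty : dec set0
| dec_step A S : dec A -> S != set0 -> [disjoint A & S] -> independent E S ->
    ~~ odd #|induced E (A :|: S)| -> dec (A :|: S).

Lemma dec_even A : dec A -> ~~ odd #|induced E A|.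
Proof. by case=> //; rewrite induced0 cards0. Qed.

Lemma dec_setT : dec setT -> even_decomposable E.
Proof.
suff chain A : dec A -> exists (k : nat) (V : nat -> {set 'I_n}),
    [/\ V 0 = A, V k = set0 & forall i, i < k ->
      [/\ V i.+1 \proper V i, ~~ odd #|induced E (V i)| &
          independent E (V i :\: V i.+1)]] by exact: chain.
elim=> {A} [|A S _ [k [V [V0 Vk HV]]] S0 dAS iS eAS].
  by exists 0, (fun=> set0).
exists k.+1, (fun i => if i is j.+1 then V j else A :|: S); split=> // -[_|i].
  rewrite V0 setDUl setDv set0U; split=> //.
    rewrite properE subsetUl subUset subxx /=.
    apply: contra S0 => SA; rewrite -(setIidPr SA) setI_eq0 disjoint_sym.
    by rewrite disjoint_sym.
  have -> // : S :\: A = S.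
  by apply/setDidPl; rewrite disjoint_sym.
by rewrite ltnS => /HV.
Qed.

Lemma dec_add1 A v : dec A -> v \notin A -> ~~ par A v -> dec (v |: A).
Proof.
move=> dA vA ev; rewrite setUC; apply: dec_step => //.
- by apply/set0Pn; exists v; rewrite inE.
- by rewrite disjoint_sym disjoints1.
- apply/forall_inP => e eE; apply/negP => /subset_leq_card.
  by rewrite cards1 card_edge.
- by rewrite setUC odd_inducedU1 // (negbTE ev) addbF dec_even.
Qed.

(** By [parU1], inserting [u] does not change the parity of its non-neighbour [v], so the two equal
    parities cancel in the edge count. *)
Lemma dec_add2 A u v : dec A -> u \notin A -> v \notin A -> u != v ->
  ~~ adj u v -> par A u = par A v -> dec (v |: (u |: A)).
Proof.
move=> dA uA vA uv nuv puv.
have -> : v |: (u |: A) = A :|: [set u; v] by rewrite setUA setUC (setUC [set v]).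
apply: dec_step => //.
- by apply/set0Pn; exists v; rewrite set22.
- rewrite -setI_eq0; apply/eqP/setP=> w; rewrite !inE.
  by apply/negP=> /andP[wA /orP[]/eqP we]; rewrite -we wA in uA vA.
- apply/forall_inP => e eE; apply: contra nuv => sub.
  rewrite /adj; suff <- : e = [set u; v] by [].
  by apply/eqP; rewrite eqEcard sub (card_edge eE) cards2 uv.
- have -> : A :|: [set u; v] = v |: (u |: A).
    by rewrite setUA [in RHS]setUC (setUC [set v]).
  rewrite odd_inducedU1 ?odd_inducedU1 ?parU1 //; last first.
    by rewrite !inE negb_or eq_sym uv.
  by rewrite puv (negbTE nuv) addbF -addbA addbb addbF dec_even.
Qed.

(** Apply [dec_add1] and [dec_add2] inside [U] as long as possible. When both are blocked, every
    remaining vertex is odd and no two of them are nonadjacent. *)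
Lemma dec_grow A U : dec A -> A \subset U -> exists B,
  [/\ dec B, A \subset B, B \subset U &
      {in U :\: B, forall u, par B u} /\
      {in U :\: B &, forall u v, u != v -> adj u v}].
Proof.
have [k] := ubnP #|U :\: A|; elim: k A => // k IHk A ltk dA sAU.
have rec B : A \proper B -> B \subset U -> dec B -> exists B0,
  [/\ dec B0, A \subset B0, B0 \subset U &
      {in U :\: B0, forall u, par B0 u} /\
      {in U :\: B0 &, forall u v, u != v -> adj u v}].
  move=> pAB sBU dB; have [|//|//|B0 [? sBB0 ? ?]] := IHk B.
    apply: leq_trans _ (ltnSE ltk); apply: proper_card.
    have /properP[sAB [x xB xA]] := pAB.
    apply/properP; split; first exact: setDS.
    by exists x; rewrite !inE ?xB ?xA ?(subsetP sBU).
  by exists B0; split=> //; apply: subset_trans (proper_sub pAB) sBB0.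
case: (pickP [pred u | (u \in U :\: A) && ~~ par A u]) => [u|alo].
  rewrite /= inE => /andP[/andP[uA uU] eu].
  apply: (rec (u |: A)); last exact: dec_add1.
    by rewrite properUr // sub1set.
  by rewrite subUset sub1set uU.
have allodd : {in U :\: A, forall u, par A u}.
  by move=> u uUA; move: (alo u); rewrite /= uUA => /negbFE.
case: (pickP [pred w | [&& w.1 \in U :\: A, w.2 \in U :\: A, w.1 != w.2 &
                          ~~ adj w.1 w.2]]) => [[u v]|clq]; last first.
  exists A; split=> //; split=> // u v uP vP uv.
  by move: (clq (u, v)); rewrite /= uP vP uv => /negbFE.
move=> /and4P[/= uP vP uv nuv].
move: (uP) (vP); rewrite !inE => /andP[uA uU] /andP[vA vU].
apply: (rec (v |: (u |: A))); last by apply: dec_add2; rewrite ?allodd.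
  apply/properP; split; last by exists v; rewrite ?setU11.
  by apply/subsetP=> w wA; rewrite !inE wA !orbT.
by rewrite !subUset !sub1set uU vU.
Qed.
End Decomposition.

(** * Absorbing an induced P4 *)

(* [if] instead of [||] and [&&], here and below, because [vm_compute] is
   call-by-value. *)
Fixpoint pick_rest T (p : T -> seq T -> bool) (l s : seq T) : bool :=
  if s is x :: s' then
    if p x (catrev l s') then true else pick_rest p (x :: l) s'
  else false.

Lemma pick_restP (T : eqType) (p : T -> seq T -> bool) l s :
  pick_rest p l s -> exists x r, perm_eq (catrev l s) (x :: r) /\ p x r.
Proof.
elim: s l => //= x s IHs l; case: ifP => [px _|_ /IHs //].
exists x, (catrev l s); split=> //.
by rewrite !catrevE perm_catC /= perm_cons perm_catC.
Qed.

(** The counterpart of [parU1] on recorded parities, for when vertex [i] joins the decomposable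
    set. *)
Definition flip (a : rel nat) (i : nat) (s : seq (nat * bool)) :=
  [seq (y.1, y.2 (+) a i y.1) | y <- s].

(* A state lists the outside vertices, named by numbers, each with the parity of
   its number of neighbours in the current decomposable set; [absorb] searches
   for additions that leave at most two of them. *)
Fixpoint absorb (a : rel nat) (k : nat) (s : seq (nat * bool)) : bool :=
  if s is [:: _, _, _ & _] then
    if k is k'.+1 then
      pick_rest (fun x r => let s1 := flip a x.1 r in
        if x.2 then
          pick_rest (fun y r1 => if y.2 then
            if a x.1 y.1 then false else absorb a k' (flip a y.1 r1)
          else false) [::] s1
        else absorb a k' s1) [::] s
    else false
  else true.

Fixpoint allbits k (P : pred (seq bool)) : bool :=
  if k is k'.+1 then
    if allbits k' (fun s => P (true :: s))
    then allbits k' (fun s => P (false :: s)) else false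
  else P [::].

Lemma allbitsP k (P : pred (seq bool)) s : allbits k P -> size s = k -> P s.
Proof.
elim: k P s => [|k IHk] P [|[] s] //=.
  by case: ifP => // + _ [] => /IHk; apply.
by case: ifP => // _ /IHk + [] => /[apply].
Qed.

Fixpoint allpats w k (P : pred (seq (seq bool))) : bool :=
  if k is k'.+1 then allbits w (fun p => allpats w k' (fun l => P (p :: l)))
  else P [::].

Lemma allpatsP w (P : pred (seq (seq bool))) l :
  allpats w (size l) P -> all (fun p => size p == w) l -> P l.
Proof.
elim: l P => [|p l IHl] P //= H /andP[/eqP sp sl].
by have /IHl := allbitsP H sp; apply.
Qed.

Definition code (p : seq bool) := foldr (fun (b : bool) m => b + m.*2) 0 p.

(* Adjacency rows of the path 0-1-2-3 and of a clique 4, 5, ... whose adjacencies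
   to the path are [pats]. *)
Definition p4_rows (pats : seq (seq bool)) : seq (seq bool) :=
  [seq [seq (i.+1 == j) || (j.+1 == i) | j <- iota 0 4] ++
       [seq nth false p i | p <- pats] | i <- iota 0 4] ++
  [seq nth [::] pats i ++ [seq i != j | j <- iota 0 (size pats)]
       | i <- iota 0 (size pats)].

Definition rows_adj (t : seq (seq bool)) : rel nat :=
  fun i j => nth false (nth [::] t i) j.

(* The order of the clique vertices is irrelevant, hence the restriction to sorted
   codes. *)
Definition p4_absorbs k := allpats 4 k (fun pats =>
  if sorted leq (map code pats) then
    let a := rows_adj (p4_rows pats) in
    allbits 4 (fun z => absorb a 5 (zip (iota 0 (4 + k)) (z ++ nseq k true)))
  else true).

(** The finite check, by evaluation. Fuel 5 is enough: each move removes at least one of at most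
    seven vertices, and the search stops at two. Cliques smaller than three are included because
    fewer vertices may be left over. *)
Lemma p4_absorbs_le3 k : k <= 3 -> p4_absorbs k.
Proof. by case: k => [|[|[|[|]]]] // _; vm_compute. Qed.

Lemma card_subset_ex (T : finType) (A : {set T}) k : k <= #|A| ->
  exists B : {set T}, B \subset A /\ #|B| = k.
Proof.
move=> /card_geqP[s [us <- sA]]; exists [set x in s]; split.
  by apply/subsetP=> x; rewrite inE => /sA.
by rewrite cardsE; apply/card_uniqP.
Qed.

Section Absorb.
Variables (n : nat) (E : {set {set 'I_n}}).
Hypothesis graphE : is_graph E.
Implicit Types (A B D U R : {set 'I_n}) (u v : 'I_n).
Local Notation adj := (adj E).
Local Notation par := (par E).
Local Notation dec := (dec E).

(** The invariant tying a run of [absorb] to the graph: [f] interprets names as vertices, and [D]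
    stays fixed while [A] grows and [s] shrinks. *)
Definition state (f : nat -> 'I_n) A D (s : seq (nat * bool)) :=
  [/\ A \subset D, D :\: A =i [seq f x.1 | x <- s], uniq [seq f x.1 | x <- s] &
      {in s, forall x, par A (f x.1) = x.2}].

Lemma state_out f A D s x : state f A D s -> x \in s -> f x.1 \notin A.
Proof.
case=> _ DA _ _ xs; have : f x.1 \in D :\: A.
  by rewrite DA; apply/mapP; exists x.
by rewrite inE => /andP[].
Qed.

Lemma unzip1_flip a i s : unzip1 (flip a i s) = unzip1 s.
Proof. by rewrite /unzip1 -map_comp. Qed.

Lemma state_add f a A D s x r :
  {in unzip1 s &, forall i j, a i j = adj (f i) (f j)} ->
  state f A D s -> perm_eq s (x :: r) ->
  state f (f x.1 |: A) D (flip a x.1 r) /\ {subset unzip1 r <= unzip1 s}.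
Proof.
move=> af sA sxr; have xs : x \in s by rewrite (perm_mem sxr) mem_head.
have rs : {subset r <= s}.
  by move=> y yr; rewrite (perm_mem sxr) inE yr orbT.
split; last by move=> i /mapP[y yr ->]; apply: map_f; apply: rs.
have xA := state_out sA xs; case: sA => AD DA us pA.
have fE : [seq f y.1 | y <- flip a x.1 r] = [seq f y.1 | y <- r].
  by rewrite /flip -map_comp.
have ps := perm_map (fun y => f y.1) sxr.
move: (us); rewrite (perm_uniq ps) /= => /andP[xs' us'].
split; rewrite ?fE //.
- rewrite subUset AD andbT sub1set.
  have : f x.1 \in D :\: A by rewrite DA; apply/mapP; exists x.
  by rewrite inE => /andP[].
- move=> v; have := DA v; rewrite (perm_mem ps) !inE.
  case: (eqVneq v (f x.1)) => [->|nv] /=; last by [].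
  by rewrite (negbTE xs').
- move=> _ /mapP[y /rs ys ->] /=.
  by rewrite parU1 // pA // af //; apply: map_f.
Qed.

(** Induction on the fuel: an even pick is a use of [dec_add1], a pair of odd nonadjacent picks a
    use of [dec_add2]. *)
Lemma absorb_sound f a k s A D :
  {in unzip1 s &, forall i j, a i j = adj (f i) (f j)} ->
  dec A -> state f A D s -> absorb a k s ->
  exists B, [/\ dec B, B \subset D & #|D :\: B| <= 2].
Proof.
have small A0 s0 : dec A0 -> state f A0 D s0 -> size s0 <= 2 ->
    exists B, [/\ dec B, B \subset D & #|D :\: B| <= 2].
  move=> dA [AD DA us _] s2; exists A0; split=> //; apply: leq_trans s2.
  by rewrite (eq_card DA) -(size_map (fun x => f x.1)) card_size.
have big k0 s0 : absorb a k0.+1 s0 = (size s0 <= 2) ||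
      pick_rest (fun x r => let s1 := flip a x.1 r in
        if x.2 then
          pick_rest (fun y r1 => if y.2 then
            if a x.1 y.1 then false else absorb a k0 (flip a y.1 r1)
          else false) [::] s1
        else absorb a k0 s1) [::] s0.
  by case: s0 => [|? [|? [|? ?]]].
elim: k s A => [|k IHk] s A af dA sA.
  by case: s sA af => [|? [|? [|? ?]]] // sA _ _; apply: small sA _.
rewrite big => /orP[/(small _ _ dA sA) //|/pick_restP[x [r [sxr]]]] /=.
have xs : x \in s by rewrite (perm_mem sxr) mem_head.
have xA := state_out sA xs; have [sA1 rs] := state_add af sA sxr.
set s1 := flip _ _ _ in sA1 *.
have af1 : {in unzip1 s1 &, forall i j, a i j = adj (f i) (f j)}.
  by move=> i j; rewrite unzip1_flip => /rs is1 /rs js1; apply: af.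
have pAx : par A (f x.1) = x.2 by case: sA => _ _ _; apply.
case: ifP => [x2|x2 ab]; last first.
  by apply: (IHk s1 (f x.1 |: A)) => //; apply: dec_add1; rewrite ?pAx ?x2.
case/pick_restP=> y [r1 [sxr1]]; case: ifP => // y2; case: ifP => // axy.
have ys1 : y \in s1 by rewrite (perm_mem sxr1) mem_head.
have yA := state_out sA1 ys1; have [sA2 rs1] := state_add af1 sA1 sxr1.
have axyE : adj (f x.1) (f y.1) = false.
  have y1 : y.1 \in unzip1 s.
    by apply: rs; rewrite -(unzip1_flip a x.1); apply: map_f.
  by rewrite -af ?axy //; apply: map_f.
move: (yA); rewrite !inE negb_or => /andP[yx yA'].
apply: (IHk _ (f y.1 |: (f x.1 |: A))) => //.
  by move=> i j; rewrite unzip1_flip => /rs1 is1 /rs1 js1; apply: af1.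
apply: dec_add2 => //; rewrite ?axyE // 1?eq_sym // pAx x2.
(* The parity stored for the second pick already counts the first one; nonadjacency makes it the
   parity towards [A] as well. *)
have : par (f x.1 |: A) (f y.1) = y.2 by case: sA1 => _ _ _; apply.
by rewrite parU1 // axyE addbF y2.
Qed.

(** * Decomposability of K4-free graphs *)

Definition clique U := {in U &, forall u v, u != v -> adj u v}.

Lemma dec_even_add1 U v : v \in U -> ~~ odd #|induced E U| ->
  ~~ par (U :\ v) v -> ~~ odd #|induced E (U :\ v)|.
Proof.
move=> vU; rewrite -{1}(setD1K vU) odd_inducedU1 ?setD11 //.
by case: (par _ _) => //; rewrite addbF.
Qed.

(** Peel from the top: removing a vertex of even degree, or two nonadjacent vertices of odd degree,
    keeps the edge count even. If neither exists, [U] is a clique with all degrees odd and at most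
    three vertices, so it is empty or a single edge, and the latter has an odd edge count. *)
Lemma k4free_dec U : (forall K : {set 'I_n}, K \subset U -> #|K| = 4 -> ~ clique K) ->
  ~~ odd #|induced E U| -> dec U.
Proof.
have [k] := ubnP #|U|; elim: k U => // k IHk U ltk free evU.
have freeS (W : {set 'I_n}) : W \subset U ->
    forall K : {set 'I_n}, K \subset W -> #|K| = 4 -> ~ clique K.
  by move=> WU K KW; exact: free (subset_trans KW WU).
case: (pickP [pred u | (u \in U) && ~~ par (U :\ u) u]) => [u /andP[/= uU pu]|alo].
  rewrite -(setD1K uU); apply: dec_add1; rewrite ?setD11 //.
  apply: IHk; last exact: dec_even_add1.
    by move: ltk; rewrite (cardsD1 u) uU.
  exact/freeS/subD1set.
have allodd u : u \in U -> par (U :\ u) u.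
  by move=> uU; move: (alo u); rewrite /= uU => /negbFE.
have pairE u v : u \in U -> v \in U -> u != v ->
    [/\ v |: (u |: (U :\ u :\ v)) = U, u \notin U :\ u :\ v & v \notin U :\ u :\ v].
  move=> uU vU uv; rewrite !inE !eqxx !andbF; split=> //.
  apply/setP=> w; rewrite !inE; case: (eqVneq w v) => [->|_] /=; first by rewrite vU.
  by case: (eqVneq w u) => [->|_] /=; rewrite ?uU.
case: (pickP [pred w | [&& w.1 \in U, w.2 \in U, w.1 != w.2 &
                          ~~ adj w.1 w.2]]) => [[u v]|clq].
  move=> /and4P[/= uU vU uv nuv]; have [UE uD vD] := pairE u v uU vU uv.
  have vDu : v |: (U :\ u :\ v) = U :\ u.
    by rewrite setD1K // !inE eq_sym uv vU.
  have uDv : u |: (U :\ u :\ v) = U :\ v.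
    apply/setP=> w; rewrite !inE; case: (eqVneq w u) => [->|_] /=.
      by rewrite uv uU.
    by [].
  have pu : par (U :\ u :\ v) u.
    by have := allodd u uU; rewrite -{1}vDu parU1 // adjC (negbTE nuv) addbF.
  have pv : par (U :\ u :\ v) v.
    by have := allodd v vU; rewrite -uDv parU1 // (negbTE nuv) addbF.
  rewrite -UE; apply: dec_add2; rewrite ?pu ?pv //; apply: IHk.
  - apply: leq_trans _ (ltnSE ltk); rewrite (cardsD1 u U) uU ltnS.
    exact/subset_leq_card/subD1set.
  - by apply: freeS; apply: subset_trans (subD1set _ _) (subD1set _ _).
  - move: evU; rewrite -{1}UE odd_inducedU1 ?odd_inducedU1 ?parU1 //.
      by rewrite pu pv (negbTE nuv) addbF -addbA addbb addbF.
    by rewrite !inE negb_or eq_sym uv eqxx.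
have clqU : clique U.
  by move=> u v uU vU uv; move: (clq (u, v)); rewrite /= uU vU uv => /negbFE.
have parE u (W : {set 'I_n}) : u \in U -> W \subset U -> u \notin W -> par W u = odd #|W|.
  move=> uU WU uW; congr odd; apply: eq_card => w; rewrite !inE.
  case: (boolP (w \in W)) => //= wW; apply: clqU => //.
    exact: (subsetP WU).
  by apply: contraNneq uW => <-.
have cardU : #|U| <= 3.
  rewrite leqNgt; apply/negP => /card_subset_ex[K [KU K4]].
  apply: (free K KU K4) => u v uK vK; apply: clqU; exact: (subsetP KU).
have [->|/set0Pn[u uU]] := eqVneq U set0; first exact: dec_empty.
have := allodd u uU; rewrite parE ?subD1set ?setD11 //.
move: cardU; rewrite (cardsD1 u) uU.
case cUu : #|U :\ u| => [|[|[|]]] // _ _.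
move/eqP/cards1P: cUu => [v Uu].
have vUu : v \in U :\ u by rewrite Uu inE.
move: (vUu); rewrite !inE => /andP[vu vU].
move: evU; rewrite -(setD1K uU) odd_inducedU1 ?setD11 // Uu.
rewrite -[X in induced E X]setU0 odd_inducedU1 ?inE // (induced0 graphE) cards0.
rewrite !parE ?sub0set ?inE ?sub1set // ?cards0 ?cards1 //.
by rewrite eq_sym.
Qed.

End Absorb.

(** * From the finite check to arbitrary graphs *)

Definition is_p4 T (e : rel T) (a b c d : T) : bool :=
  [&& e a b, e b c, e c d, ~~ e a c, ~~ e b d & ~~ e a d].

Section P4Absorb.
Variables (n : nat) (E : {set {set 'I_n}}).
Hypothesis graphE : is_graph E.
Implicit Types (A B D U R : {set 'I_n}) (u v : 'I_n) (r : seq 'I_n).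
Local Notation adj := (adj E).
Local Notation par := (par E).
Local Notation dec := (dec E).

Lemma absorb_sorted A D a b c d r :
  let x := [:: a; b; c; d] in let pat v := [seq adj s v | s <- x] in
  dec A -> A \subset D -> D :\: A =i x ++ r -> uniq (x ++ r) -> size r <= 3 ->
  is_p4 adj a b c d -> {in r &, forall u v, u != v -> adj u v} ->
  {in r, forall u, par A u} -> sorted leq (map code (map pat r)) ->
  exists B, [/\ dec B, B \subset D & #|D :\: B| <= 2].
Proof.
move=> x pat dA AD DA us r3 P4 clq odd_r srt; set k := size r.
have abs0 := p4_absorbs_le3 r3; rewrite /p4_absorbs -(size_map pat) in abs0.
have pat4 : all (fun p => size p == 4) (map pat r).
  by apply/allP=> _ /mapP[v _ ->].
have := allpatsP abs0 pat4; rewrite srt size_map.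
move/(@allbitsP _ _ [seq par A s | s <- x]) => /(_ erefl).
set s := zip _ _; set t := rows_adj _ => abs.
have sE : unzip1 s = iota 0 (size (x ++ r)).
  by rewrite unzip1_zip ?size_cat ?size_iota ?size_nseq.
(* The default [a] is never reached, since all names in [s] are below [size (x ++ r)]. *)
pose f i := nth a (x ++ r) i.
have fE : [seq f y.1 | y <- s] = x ++ r.
  have -> : [seq f y.1 | y <- s] = map f (unzip1 s) by rewrite -map_comp.
  by rewrite sE map_nth_iota0 // take_size.
apply: (@absorb_sound _ E graphE f t 5 s A D _ dA _ abs).
  move=> i j; rewrite sE !mem_iota /= !add0n /t /f.
  move: (us) clq => {abs abs0 srt sE fE us odd_r k s DA pat4 t f}.
  case/and5P: P4 => ab bc cd nac /andP[nbd nad].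
  have [ba cb dc] : [/\ adj b a, adj c b & adj d c].
    by rewrite (adjC _ b a) (adjC _ c b) (adjC _ d c).
  have [nca ndb nda] : [/\ ~~ adj c a, ~~ adj d b & ~~ adj d a].
    by rewrite (adjC _ c a) (adjC _ d b) (adjC _ d a).
  have E0 b0 : ~~ b0 -> false = b0 by case: b0.
  (* With at most seven vertices, the table is compared with the graph entry by entry. *)
  case: r r3 => [|u [|v [|w [|? ?]]]] // _ us clq;
    case: i => [|[|[|[|[|[|[|i]]]]]]] //; case: j => [|[|[|[|[|[|[|j]]]]]]] //= _ _;
    rewrite /rows_adj /= ?adjxx //; try exact: E0; try exact: adjC;
    symmetry; apply: clq; rewrite ?inE ?eqxx ?orbT //;
    apply: contraTneq us => ->; rewrite /= !inE !eqxx ?orbT ?andbF //.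
split=> //; rewrite ?fE //; apply/eq_in_map.
have -> : [seq par A (f y.1) | y <- s] = map (par A) [seq f y.1 | y <- s].
  by rewrite -map_comp.
have -> : [seq y.2 | y <- s] = map (par A) x ++ nseq k true.
  by rewrite -[LHS]/(unzip2 s) unzip2_zip // size_iota size_cat size_nseq.
rewrite fE map_cat; congr (_ ++ _).
by rewrite /k -(size_map (par A) r); apply/all_pred1P/allP=> _ /mapP[u ur ->]; rewrite /= odd_r.
Qed.

Lemma absorb_p4 A D a b c d r :
  let x := [:: a; b; c; d] in
  dec A -> A \subset D -> D :\: A =i x ++ r -> uniq (x ++ r) -> size r <= 3 ->
  is_p4 adj a b c d -> {in r &, forall u v, u != v -> adj u v} ->
  {in r, forall u, par A u} ->
  exists B, [/\ dec B, B \subset D & #|D :\: B| <= 2].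
Proof.
move=> x dA AD DA us r3 P4 clq odd_r.
pose pat v := [seq adj s v | s <- x].
pose le u v := code (pat u) <= code (pat v).
have pr : perm_eq (sort le r) r by rewrite perm_sort.
have pxr : perm_eq (x ++ sort le r) (x ++ r) by rewrite perm_cat2l.
apply: (@absorb_sorted A D a b c d (sort le r)) => //.
- by move=> y; rewrite DA (perm_mem pxr).
- by rewrite (perm_uniq pxr).
- by rewrite size_sort.
- by move=> u v; rewrite !(perm_mem pr); apply: clq.
- by move=> u; rewrite (perm_mem pr); apply: odd_r.
rewrite -map_comp sorted_map; apply: sort_sorted => u v; exact: leq_total.
Qed.

(** First grow [A] inside [A :|: R], so that the remainder [R1] is a clique of odd vertices. Then
    run [absorb_p4] on the path and up to three vertices of [R1]: three clique vertices are traded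
    for at most two left-over ones. *)
Lemma absorb_step A R a b c d :
  let S := [set x in [:: a; b; c; d]] in
  dec A -> uniq [:: a; b; c; d] -> [disjoint A & R] -> [disjoint A :|: R & S] ->
  is_p4 adj a b c d ->
  let D := A :|: R :|: S in
  exists B, [/\ dec B, B \subset D & #|D :\: B| <= maxn #|R|.-1 2].
Proof.
move=> S dA ux dAR dARS P4 D.
have [A1 [dA1 AA1 A1D [odd1 clq1]]] := dec_grow graphE dA (subsetUl A R).
set R1 := (A :|: R) :\: A1 in odd1 clq1.
have R1R : R1 \subset R.
  apply/subsetP=> u; rewrite !inE => /andP[uA1 /orP[uA|//]].
  by rewrite (subsetP AA1) in uA1.
pose r := take 3 (enum R1).
have rR1 : {subset r <= R1} by move=> u /mem_take; rewrite mem_enum.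
pose D1 := A1 :|: S :|: [set u in r].
have SE u : (u \in S) = (u \in [:: a; b; c; d]) by rewrite in_set.
have dis u : u \in S -> u \notin A :|: R.
  by move=> uS; apply: contraL uS => uAR; rewrite (disjointFr dARS).
have [|||||||B [dB BD1 cB]] := @absorb_p4 A1 D1 a b c d r dA1.
- by rewrite /D1 -setUA subsetUl.
- move=> u; rewrite /D1 mem_cat -SE in_setD !in_setU [u \in [set _ in r]]in_set.
  case uA1: (u \in A1) => //=; apply/esym/negbTE; rewrite negb_or.
  rewrite (contraL (dis u) (subsetP A1D u uA1)) /=.
  by apply/negP => /rR1; rewrite inE uA1.
- rewrite cat_uniq ux take_uniq ?enum_uniq // andbT /=.
  apply/hasPn => u /rR1; rewrite inE => /andP[_ uAR].
  by rewrite -SE (contraL (dis u)).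
- by rewrite size_take; case: ltnP.
- by [].
- by move=> u v /rR1 uR /rR1 vR; apply: clq1.
- by move=> u /rR1; apply: odd1.
have rD : [set u in r] \subset R1 by apply/subsetP=> u; rewrite inE => /rR1.
have DE : D = D1 :|: (R1 :\: [set u in r]).
  apply/setP=> u; rewrite /D /D1 !(in_setU, in_setD) [u \in [set _ in r]]in_set.
  case ur: (u \in r); rewrite /= ?orbT ?orbF.
    by have := rR1 u ur; rewrite in_setD in_setU => /andP[_ ->].
  case uA1: (u \in A1) => /=; last by rewrite orbC.
  by have := subsetP A1D u uA1; rewrite in_setU => ->.
exists B; split=> //.
  by apply: subset_trans BD1 _; rewrite DE subsetUl.
have : #|D :\: B| <= #|D1 :\: B| + #|R1 :\: [set u in r]|.
  apply: leq_trans (subset_leq_card _) (leq_card_setU _ _).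
  by rewrite DE setDUl setUS // subsetDl.
have cr : #|[set u in r]| = minn 3 #|R1|.
  rewrite cardsE; have /card_uniqP-> : uniq r by rewrite take_uniq ?enum_uniq.
  by rewrite size_take -cardE; case: ltngtP => //; lia.
have := cardsD R1 [set u in r]; rewrite (setIidPr rD) cr.
have := subset_leq_card R1R; move: cB; lia.
Qed.
End P4Absorb.

(** * Pure pairs *)

Definition has_p4 (T : finType) (e : rel T) (U : {set T}) :=
  exists a b c d, [/\ a \in U, b \in U, c \in U & d \in U] /\ is_p4 e a b c d.

Definition pure (T : finType) (e : rel T) (b : bool) (X Y : {set T}) :=
  {in X & Y, forall x y, e x y = b}.

Definition splits (T : finType) (e : rel T) (b : bool) (U : {set T}) :=
  exists X Y : {set T},
    [/\ X != set0, Y != set0, X :|: Y = U & [disjoint X & Y]] /\ pure e b X Y.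

Definition corel (T : eqType) (e : rel T) : rel T :=
  fun x y => (x != y) && ~~ e x y.

Lemma disjoint_setU1 (T : finType) (x : T) (A B : {set T}) : x \notin A ->
  [disjoint A & x |: B] = [disjoint A & B].
Proof.
move=> xA; rewrite -!setI_eq0 setIUr (_ : A :&: [set x] = set0) ?set0U //.
by apply/eqP; rewrite setI_eq0 disjoint_sym disjoints1.
Qed.

Section PurePairs.
Variables (T : finType) (e : rel T).
Hypotheses (eC : symmetric e) (exx : irreflexive e).
Implicit Types (U W X Y : {set T}).

Lemma has_p4S U W : U \subset W -> has_p4 e U -> has_p4 e W.
Proof.
move=> /subsetP UW [a [b [c [d [[aU bU cU dU] P]]]]].
by exists a, b, c, d; split=> //; split; apply: UW.
Qed.

Lemma p4_uniq a b c d : is_p4 e a b c d -> uniq [:: a; b; c; d].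
Proof.
case/and5P=> ab bc cd nac /andP[nbd nad] /=; rewrite !inE !negb_or.
have neq x y : e x y -> x != y by apply: contraTneq => ->; rewrite exx.
rewrite (neq a b) ?(neq b c) ?(neq c d) //= andbT; apply/andP; split; first (apply/andP; split).
- by apply: contraNneq nad => ->.
- by apply: contraNneq nbd => <-; rewrite eC.
- by apply: contraNneq nad => <-.
Qed.

(** A side without neighbours of [v] splits off. Otherwise an edge inside one side from a neighbour
    [a] to a non-neighbour [b] of [v] gives the path [b], [a], [v], [y1] with [y1] a neighbour on
    the other side. Without such edges the non-neighbours of [v] split off, or [v] is joined to
    everything. *)
Lemma extend_split v X Y : v \notin X :|: Y -> X != set0 -> Y != set0 ->
  [disjoint X & Y] -> pure e false X Y ->
  has_p4 e (v |: (X :|: Y)) \/ exists b, splits e b (v |: (X :|: Y)).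
Proof.
move=> vXY X0 Y0 dXY pXY.
have pYX : pure e false Y X by move=> y x yY xX; rewrite eC pXY.
move: (vXY); rewrite inE negb_or => /andP[vX vY].
have half X1 Y1 : v \notin X1 -> v \notin Y1 -> X1 != set0 -> [disjoint X1 & Y1] ->
    pure e false X1 Y1 -> [set x in X1 | e v x] = set0 ->
    splits e false (v |: (X1 :|: Y1)).
  move=> v1 v2 X10 d1 p1 N0; exists X1, (v |: Y1); split.
    split=> //; first by apply/set0Pn; exists v; rewrite setU11.
      by rewrite setUCA.
    by rewrite disjoint_setU1.
  move=> x y xX1; rewrite !inE => /orP[/eqP->|]; last exact: p1.
  rewrite eC; apply: contraTF xX1 => exv.
  by apply/negP=> xX1; have := in_set0 x; rewrite -N0 inE xX1 exv.
have [NX0|/set0Pn[x]] := eqVneq [set x in X | e v x] set0.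
  by right; exists false; apply: half.
have [NY0|/set0Pn[y]] := eqVneq [set y in Y | e v y] set0.
  by right; exists false; rewrite setUC (setUC X) setUC; apply: half;
     rewrite // disjoint_sym.
rewrite !inE => /andP[yY vy] /andP[xX vx].
have path X1 Y1 a b y1 : pure e false X1 Y1 -> X1 :|: Y1 = X :|: Y -> a \in X1 ->
    b \in X1 -> e v a -> ~~ e v b -> e a b -> y1 \in Y1 -> e v y1 ->
    has_p4 e (v |: (X :|: Y)).
  move=> p1 <- aX bX va nvb ab yY1 vy1; exists b, a, v, y1.
  rewrite !inE aX bX yY1 eqxx !orbT; split=> //.
  rewrite /is_p4 (eC b a) ab (eC a v) va vy1 (eC b v) nvb.
  by rewrite p1 // p1.
case: (pickP [pred w | [&& w.1 \in X, w.2 \in X, e v w.1, ~~ e v w.2 & e w.1 w.2]]).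
  by move=> [a b] /and5P[/= aX bX va nvb ab]; left; apply: (path X Y a b y).
move=> nX.
case: (pickP [pred w | [&& w.1 \in Y, w.2 \in Y, e v w.1, ~~ e v w.2 & e w.1 w.2]]).
  move=> [a b] /and5P[/= aY bY va nvb ab]; left; apply: (path Y X a b x) => //.
  exact: setUC.
move=> nY; right.
have [M0|M0] := eqVneq [set w in X :|: Y | ~~ e v w] set0.
  exists true, [set v], (X :|: Y); split; first split=> //.
  - by apply/set0Pn; exists v; rewrite inE.
  - by apply: contra X0; rewrite setU_eq0 => /andP[->].
  - by rewrite disjoints1.
  move=> _ w /set1P-> wXY; apply/negbNE/negP => nvw.
  by have := in_set0 w; rewrite -M0 inE wXY nvw.
exists false, [set w in X :|: Y | ~~ e v w], (v |: [set w in X :|: Y | e v w]).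
split; first split=> //.
- by apply/set0Pn; exists v; rewrite setU11.
- rewrite setUCA; congr (_ |: _); apply/setP=> w; rewrite !inE.
  by case: (e v w); rewrite ?andbT ?andbF ?orbF.
- rewrite -setI_eq0; apply/eqP/setP=> w; rewrite !inE.
  case: eqVneq => [->|_] /=; first by rewrite (negbTE vX) (negbTE vY).
  by case: (e v w); rewrite ?andbF.
move=> b a; rewrite !inE => /andP[bXY nvb] /orP[/eqP->|/andP[aXY va]].
  by rewrite eC (negbTE nvb).
case/orP: aXY => [aX|aY]; case/orP: bXY => [bX|bY].
- by have := nX (a, b); rewrite /= aX bX va nvb eC.
- exact: pYX.
- exact: pXY.
- by have := nY (a, b); rewrite /= aY bY va nvb eC.
Qed.

End PurePairs.

Section CographPairs.
Variables (T : finType) (e : rel T).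
Hypothesis eC : symmetric e.
Implicit Types (U W X Y P Q : {set T}).

Lemma corelC : symmetric (corel e).
Proof. by move=> x y; rewrite /corel eq_sym eC. Qed.

Lemma corelxx : irreflexive (corel e).
Proof. by move=> x; rewrite /corel eqxx. Qed.

(** The path on four vertices is self-complementary. *)
Lemma p4_corel a b c d : is_p4 (corel e) a b c d -> is_p4 e b d a c.
Proof.
move=> P; have := p4_uniq corelC corelxx P; rewrite /= !inE !negb_or andbT.
move=> /andP[/and3P[nab nac nad] /andP[/andP[nbc nbd] ncd]].
move: P; rewrite /is_p4 /corel nab nac nad nbc nbd ncd /= !negbK.
by move=> /and5P[ab bc cd -> /andP[-> ad]]; rewrite (eC d a) ad (eC b a) ab (eC d c) cd bc.
Qed.

Lemma pure_corel b X Y : [disjoint X & Y] -> pure (corel e) b X Y -> pure e (~~ b) X Y.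
Proof.
move=> dXY pXY x y xX yY; rewrite -(pXY x y) // /corel.
suff -> : x != y by rewrite negbK.
by apply: contraTneq yY => <-; rewrite (disjointFr dXY).
Qed.

(** Delete a vertex, split the rest by induction and put the vertex back with [extend_split],
    passing to the complement when the split is by edges. *)
Lemma p4free_splits U : 1 < #|U| -> has_p4 e U \/ exists b, splits e b U.
Proof.
have [k] := ubnP #|U|; elim: k U => // k IHk U ltk U2.
have /set0Pn[v vU] : U != set0 by rewrite -card_gt0; lia.
have UE : v |: (U :\ v) = U by rewrite setD1K.
have cardU := cardsD1 v U; rewrite vU in cardU.
have [U1|U1] := leqP #|U :\ v| 1.
  have /cards1P[w Uw] : #|U :\ v| == 1 by lia.
  right; exists (e v w), [set v], [set w]; split; last by move=> _ _ /set1P-> /set1P->.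
  rewrite -Uw setD1K //; split=> //.
  - by apply/set0Pn; exists v; rewrite inE.
  - by rewrite -card_gt0 Uw cards1.
  - by rewrite disjoints1 setD11.
have [|//||] := IHk (U :\ v).
- by lia.
- by move=> h; left; apply: has_p4S (subD1set U v) h.
case=> -[] [X [Y [[X0 Y0 XY dXY] pXY]]]; last first.
  by rewrite -UE -XY; apply: extend_split; rewrite ?XY ?setD11.
have pc : pure (corel e) false X Y.
  by move=> x y xX yY; rewrite /corel pXY // andbF.
have := extend_split corelC _ X0 Y0 dXY pc; rewrite XY => /(_ v).
rewrite setD11 UE => /(_ isT) [[a [b [c [d [[aU bU cU dU] P]]]]]|].
  by left; exists b, d, a, c; split=> //; apply: p4_corel.
case=> b [X1 [Y1 [[X10 Y10 XY1 dXY1] pXY1]]]; right; exists (~~ b), X1, Y1.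
by split=> //; apply: pure_corel.
Qed.

Lemma p4_or_pure_pair m U : 0 < m -> 4 * m <= #|U| -> has_p4 e U \/
  exists b X Y, [/\ m <= #|X|, m <= #|Y|, [disjoint X & Y] & pure e b X Y].
Proof.
move=> m0 cU; have [P4|nP4] := pselect (has_p4 e U).
  by left.
right.
have noS W : W \subset U -> ~ has_p4 e W by move=> /has_p4S WU /WU.
(* Split [X] repeatedly, keep the larger part and move the smaller one to [P] or [Q] according to
   the type of the split. The total size is preserved, and a part of size above [2 * m] has a half
   of size at least [m]. Once [X] has at most [2 * m] vertices, [P] or [Q] has at least [m]. *)
suff main k X P Q : #|X| < k -> X \subset U -> m <= #|X| ->
    4 * m <= #|X| + #|P| + #|Q| -> [disjoint X & P] -> [disjoint X & Q] ->
    pure e true X P -> pure e false X Q ->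
    exists b X Y, [/\ m <= #|X|, m <= #|Y|, [disjoint X & Y] & pure e b X Y].
  apply: (main #|U|.+1 U set0 set0) => //; rewrite ?cards0 ?addn0 //; try lia.
  - by rewrite -setI_eq0 setI0.
  - by rewrite -setI_eq0 setI0.
  - by move=> x y _; rewrite inE.
  - by move=> x y _; rewrite inE.
elim: k X P Q => // k IHk X P Q ltk XU mX cXPQ dXP dXQ pP pQ.
have [X2|X2] := leqP #|X| (2 * m).
  have [mP|mP] := leqP m #|P|; first by exists true, X, P.
  by exists false, X, Q; split=> //; lia.
have [|/(noS X XU) //|[b [Y [Z [[Y0 Z0 YZ dYZ] pYZ]]]]] := @p4free_splits X.
  by lia.
wlog leZY : Y Z Y0 Z0 YZ dYZ pYZ / #|Z| <= #|Y|.
  move=> W; case/orP: (leq_total #|Z| #|Y|) => [|leYZ]; first exact: W.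
  apply: (W Z Y) => //; [by rewrite setUC | by rewrite disjoint_sym |].
  by move=> x y xZ yY; rewrite eC pYZ.
have cX : #|X| = #|Y| + #|Z|.
  by rewrite -YZ cardsU (eqP (_ : Y :&: Z == set0)) ?cards0 ?subn0 ?setI_eq0.
have cZ : 0 < #|Z| by rewrite card_gt0.
have YX : Y \subset X by rewrite -YZ subsetUl.
have ZX : Z \subset X by rewrite -YZ subsetUr.
have dYP : [disjoint Y & P] by apply: disjointWl dXP.
have dYQ : [disjoint Y & Q] by apply: disjointWl dXQ.
have cU2 W : [disjoint X & W] -> #|Z :|: W| = #|Z| + #|W|.
  move=> dXW; rewrite cardsU (eqP (_ : Z :&: W == set0)) ?cards0 ?subn0 //.
  by rewrite setI_eq0; apply: disjointWl dXW.
have dU W : [disjoint X & W] -> [disjoint Y & Z :|: W].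
  move=> dXW; rewrite disjoint_sym -setI_eq0 setIUl setU_eq0 !setI_eq0.
  by rewrite disjoint_sym dYZ disjoint_sym; apply: disjointWl dXW.
have pY W c : pure e c X W -> pure e c Y W.
  by move=> pW x y /(subsetP YX); apply: pW.
have pU W : pure e b X W -> pure e b Y (Z :|: W).
  move=> /pY pW x y xY; rewrite inE => /orP[yZ|yW]; [exact: pYZ|exact: pW].
have YU := subset_trans YX XU.
have [Yk mY cYPQ] : [/\ #|Y| < k, m <= #|Y| & 4 * m <= #|Y| + (#|Z| + #|P|) + #|Q|].
  by split; move: ltk X2 cXPQ cX cZ leZY; clear; lia.
case: b pYZ pU => pYZ pU.
  apply: (IHk Y (Z :|: P) Q Yk YU mY _ (dU P dXP) dYQ (pU P pP) (pY Q _ pQ)).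
  by rewrite cU2.
apply: (IHk Y P (Z :|: Q) Yk YU mY _ dYP (dU Q dXQ) (pY P _ pP) (pU Q pQ)).
by rewrite cU2 //; move: cYPQ; clear; lia.
Qed.
End CographPairs.

(** * Decomposability in the absence of pure pairs *)

Section EvenDecomposable.
Variables (n : nat) (E : {set {set 'I_n}}).
Hypothesis graphE : is_graph E.
Implicit Types (A B D U R : {set 'I_n}) (u v : 'I_n).
Local Notation adj := (adj E).
Local Notation par := (par E).
Local Notation dec := (dec E).

(** Set aside an induced P4, treat the rest by induction, then absorb the path. Each path adds four
    to [#|U|] and lowers the remainder by one, which preserves [4 * #|U :\: A| + #|U|]; at the start
    fewer than [4 * m] vertices all remain, whence [20 * m]. *)
Lemma dec_almost m U :
  (forall W : {set 'I_n}, W \subset U -> 4 * m <= #|W| -> has_p4 adj W) ->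
  exists A, [/\ dec A, A \subset U &
    #|U :\: A| <= 2 \/ 4 * #|U :\: A| + #|U| <= 20 * m].
Proof.
have [k] := ubnP #|U|; elim: k U => // k IHk U ltk p4U.
have [Um|Um] := ltnP #|U| (4 * m).
  exists set0; split; rewrite ?sub0set ?setD0; first exact: dec_empty.
    by [].
  by right; lia.
have [a [b [c [d [[aU bU cU dU] P4]]]]] := p4U U (subxx U) Um.
have ux := p4_uniq (@adjC n E) (@adjxx n E graphE) P4.
pose S : {set 'I_n} := [set x in [:: a; b; c; d]].
have SU : S \subset U.
  by apply/subsetP=> x; rewrite !inE => /or4P[]/eqP->.
have cS : #|S| = 4 by rewrite cardsE; move/card_uniqP: ux.
have cUS : #|U :\: S| = #|U| - 4 by rewrite cardsD (setIidPr SU) cS.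
have cU4 : 4 <= #|U| by rewrite -cS subset_leq_card.
have [||A [dA AU HA]] := IHk (U :\: S).
- by rewrite cUS; move: ltk cU4; clear; lia.
- by move=> W WU; apply: p4U; apply: subset_trans WU (subsetDl _ _).
set R := (U :\: S) :\: A in HA.
have dAR : [disjoint A & R].
  by rewrite disjoint_sym -setI_eq0 setIDAC setDIl setDv setI0.
have ARE : A :|: R = U :\: S.
  by rewrite /R -{1}(setIidPr AU) setID.
have dARS : [disjoint A :|: R & S] by rewrite ARE -setI_eq0 setIDAC setDIl setDv setI0.
have [B [dB BD cB]] := absorb_step graphE dA ux dAR dARS P4.
have DE : A :|: R :|: S = U by rewrite ARE setUC -{1}(setIidPr SU) setID.
rewrite -/S DE in BD cB; exists B; split=> //.
move: cB HA cUS cU4; clear; lia.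
Qed.

(** After maximal growth, a single odd vertex left would make the edge count odd, and so would two
    adjacent odd ones, whose common edge counts once. *)
Lemma dec_finish A : dec A -> #|~: A| <= 2 -> ~~ odd #|E| -> dec setT.
Proof.
move=> dA cA evE.
have [B [dB AB _ [odd1 clq1]]] := dec_grow graphE dA (subsetT A).
have cB : #|~: B| <= 2 by apply: leq_trans cA; rewrite subset_leq_card ?setCS.
have [B0|/set0Pn[u uB]] := eqVneq (~: B) set0.
  by rewrite -setC0 -B0 setCK.
have pu : par B u by apply: odd1; rewrite setTD.
have uB' : u \notin B by rewrite inE in uB.
have indT : induced E setT = E.
  by apply/setP=> e; rewrite inE subsetT andbT.
have cBu := cardsD1 u (~: B); rewrite uB in cBu.
have [Bu|/set0Pn[v vB]] := eqVneq (~: B :\ u) set0.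
  move: evE; rewrite -indT.
  have -> : [set: 'I_n] = u |: B.
    by rewrite -[B in RHS]setCK -(setD1K uB) Bu setU0 setUCr.
  by rewrite odd_inducedU1 // pu (negbTE (dec_even graphE dB)).
have Bv : ~: B = [set u; v].
  apply/eqP; rewrite eq_sym eqEcard subUset !sub1set uB cards2.
  by move: vB; rewrite !inE eq_sym => /andP[-> ->].
move: vB; rewrite !inE => /andP[vu vB].
have pv : par B v by apply: odd1; rewrite !inE vB.
have auv : adj u v by apply: clq1; rewrite ?inE ?vB ?uB' // eq_sym.
move: evE; rewrite -indT.
have -> : [set: 'I_n] = v |: (u |: B).
  by rewrite setUA (setUC [set v]) -Bv setUC setUCr.
rewrite odd_inducedU1 ?odd_inducedU1 ?parU1 //; last by rewrite !inE negb_or vu.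
by rewrite pu pv auv (negbTE (dec_even graphE dB)).
Qed.

Lemma dec_or_pure_pair m : 0 < m -> 20 * m <= n -> ~~ odd #|E| ->
  even_decomposable E \/ exists b (X Y : {set 'I_n}),
    [/\ m <= #|X|, m <= #|Y|, [disjoint X & Y] & pure adj b X Y].
Proof.
move=> m0 mn evE.
have [P|nP] := pselect (exists b (X Y : {set 'I_n}),
    [/\ m <= #|X|, m <= #|Y|, [disjoint X & Y] & pure adj b X Y]).
  by right.
left; apply: dec_setT => //.
have [W _ cW|A [dA _ HA]] := @dec_almost m setT.
  have [] // := p4_or_pure_pair (@adjC n E) m0 cW.
apply: (dec_finish dA) => //; rewrite -setTD.
(* With [20 * m <= n] the second alternative leaves no vertex at all. *)
by move: HA; rewrite cardsT card_ord; case: ltngtP; lia.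
Qed.
End EvenDecomposable.

(** * The random graph *)

Local Open Scope ring_scope.

(** The binomial theorem, with subsets grouped by size. *)
Lemma sum_subsets (R : comNzRingType) (T : finType) (D : {set T}) (x y : R) :
  \sum_(E : {set T} | E \subset D) x ^+ #|E| * y ^+ (#|D| - #|E|)%N =
  (x + y) ^+ #|D|.
Proof.
rewrite addrC exprDn.
rewrite (partition_big (fun E : {set T} => inord #|E| : 'I_#|D|.+1) predT) //=.
apply: eq_bigr => i _.
rewrite -cards_draws -sumr_const; apply: eq_big => [E|E].
  rewrite inE; case ED: (E \subset D) => //=.
  by rewrite -val_eqE /= inordK // ltnS subset_leq_card.
case/andP=> ED /eqP <-; rewrite inordK ?ltnS ?subset_leq_card //.
by rewrite mulrC.
Qed.

Lemma sum_supersets (R : comNzRingType) (T : finType) (D F : {set T}) (x y : R) :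
  F \subset D ->
  \sum_(E : {set T} | (E \subset D) && (F \subset E))
     x ^+ #|E| * y ^+ (#|D| - #|E|)%N = x ^+ #|F| * (x + y) ^+ (#|D| - #|F|)%N.
Proof.
move=> FD; have cDF : #|D :\: F| = (#|D| - #|F|)%N by rewrite cardsD (setIidPr FD).
rewrite -cDF -sum_subsets big_distrr /=.
rewrite (reindex_onto (fun E => F :|: E) (fun E => E :\: F)); last first.
  by move=> E /andP[_ FE]; rewrite -{1}(setIidPr FE) setID.
apply: eq_big => [E|E]; rewrite subUset FD subsetUl andbT /= setDUl setDv set0U.
  rewrite subsetD -setI_eq0; apply: andb_id2l => _.
  by rewrite setI_eq0; apply/eqP/setDidPl.
case/andP=> _ /eqP/setDidPl dEF.
rewrite cardsU (eqP (_ : F :&: E == set0)) ?cards0 ?subn0; last first.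
  by rewrite setI_eq0 disjoint_sym.
by rewrite exprD mulrA cDF subnDA.
Qed.

Lemma sum_avoiding (R : comNzRingType) (T : finType) (D F : {set T}) (x y : R) :
  F \subset D ->
  \sum_(E : {set T} | (E \subset D) && [disjoint F & E])
     x ^+ #|E| * y ^+ (#|D| - #|E|)%N = y ^+ #|F| * (x + y) ^+ (#|D| - #|F|)%N.
Proof.
move=> FD; have cDF : #|D :\: F| = (#|D| - #|F|)%N by rewrite cardsD (setIidPr FD).
rewrite -cDF -sum_subsets big_distrr /=.
apply: eq_big => [E|E]; first by rewrite subsetD disjoint_sym.
rewrite disjoint_sym -subsetD => EDF; rewrite mulrCA -exprD; congr (_ * _ ^+ _).
have := subset_leq_card EDF; rewrite cDF; have := subset_leq_card FD; lia.
Qed.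

Section Gnp.
Variables (R : realType) (n : nat) (p : R).
Hypotheses (p0 : 0 <= p) (p1 : p <= 1).

Lemma gnp_union_bound (I : finType) (Q : pred I) (ev : I -> pred {set {set 'I_n}})
    (P : {set {set 'I_n}} -> Prop) :
  (forall E, is_graph E -> P E -> exists2 i, Q i & ev i E) ->
  gnp_prob p P <= \sum_(i | Q i) \sum_(E : {set {set 'I_n}} | is_graph E && ev i E)
     p ^+ #|E| * (1 - p) ^+ (#|pairs n| - #|E|)%N.
Proof.
move=> cover.
have w0 (E : {set {set 'I_n}}) : 0 <= p ^+ #|E| * (1 - p) ^+ (#|pairs n| - #|E|)%N.
  by rewrite mulr_ge0 ?exprn_ge0 ?subr_ge0.
rewrite (exchange_big_dep (fun E => is_graph E)) /=; last by move=> i E _ /andP[].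
rewrite /gnp_prob big_mkcondr /=; apply: ler_sum => E gE.
case: asboolP => [PE|_]; last by apply: sumr_ge0.
have [i Qi evi] := cover E gE PE.
by rewrite (bigD1 i) /= ?Qi ?gE // lerDl sumr_ge0.
Qed.

Lemma gnp_contains (F : {set {set 'I_n}}) : F \subset pairs n ->
  \sum_(E : {set {set 'I_n}} | is_graph E && (F \subset E))
     p ^+ #|E| * (1 - p) ^+ (#|pairs n| - #|E|)%N = p ^+ #|F|.
Proof. by move=> FP; rewrite sum_supersets // [p + _]addrC subrK expr1n mulr1. Qed.

Lemma gnp_avoids (F : {set {set 'I_n}}) : F \subset pairs n ->
  \sum_(E : {set {set 'I_n}} | is_graph E && [disjoint F & E])
     p ^+ #|E| * (1 - p) ^+ (#|pairs n| - #|E|)%N = (1 - p) ^+ #|F|.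
Proof. by move=> FP; rewrite sum_avoiding // [p + _]addrC subrK expr1n mulr1. Qed.

(** By [k4free_dec] a non-decomposable even graph contains a K4; each of the at most [n ^ 4]
    candidates has six edges. *)
Lemma gnp_K4_bound :
  gnp_prob p (@even_non_decomposable n) <= n%:R ^+ 4 * p ^+ 6.
Proof.
pose F (K : {set 'I_n}) := [set e : {set 'I_n} | e \subset K & #|e| == 2].
have FP K : F K \subset pairs n by apply/subsetP=> e; rewrite !inE => /andP[].
apply: le_trans (@gnp_union_bound {set 'I_n} (fun K => #|K| == 4)
  (fun K E => F K \subset E) _ _) _.
  move=> E gE [evE ndE].
  have [/existsP[K /andP[K4 FK]]|nK] :=
    boolP [exists K : {set 'I_n}, (#|K| == 4) && (F K \subset E)].
    by exists K.
  case: ndE; apply: dec_setT; apply: (k4free_dec gE); last first.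
    suff -> : induced E setT = E by [].
    by apply/setP=> e; rewrite inE subsetT andbT.
  move=> K _ K4 clK; move/existsP: nK; apply; exists K; rewrite K4 eqxx /=.
  apply/subsetP=> e; rewrite inE => /andP[eK /cards2P[x [y [xy eE]]]].
  rewrite eE; apply: clK => //; apply: (subsetP eK); rewrite eE ?set21 ?set22 //.
rewrite (eq_bigr (fun=> p ^+ 6)); last first.
  by move=> K /eqP K4; rewrite gnp_contains // cards_draws K4.
rewrite sumr_const -[leLHS]mulr_natl ler_wpM2r ?exprn_ge0 // -natrX ler_nat.
have -> : #|[pred K : {set 'I_n} | #|K| == 4]| = 'C(n, 4).
  by rewrite -[in RHS](card_ord n) -card_draws; apply: eq_card => K; rewrite !inE.
apply: (@leq_trans (n ^_ 4)); first by rewrite -bin_ffact leq_pmulr.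
by rewrite !ffactnS ffactn0 !expnS expn0 !leq_mul //; lia.
Qed.

Definition cross (X Y : {set 'I_n}) : {set {set 'I_n}} :=
  [set [set w.1; w.2] | w in setX X Y].

Lemma cross_pairs (X Y : {set 'I_n}) : [disjoint X & Y] -> cross X Y \subset pairs n.
Proof.
move=> dXY; apply/subsetP=> _ /imsetP[[x y] /setXP[/= xX yY] ->].
rewrite inE cards2; suff -> : x != y by [].
by apply: contraTneq yY => <-; rewrite (disjointFr dXY).
Qed.

Lemma card_cross (X Y : {set 'I_n}) : [disjoint X & Y] -> #|cross X Y| = (#|X| * #|Y|)%N.
Proof.
move=> dXY; rewrite card_in_imset ?cardsX //.
move=> [x y] [x' y'] /setXP[/= xX yY] /setXP[/= x'X y'Y] eq2.
have: x \in [set x'; y'] by rewrite -eq2 set21.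
have: y \in [set x'; y'] by rewrite -eq2 set22.
rewrite !inE => /orP[]/eqP yE.
  by rewrite yE (disjointFr dXY x'X) in yY.
case/orP=> /eqP xE; first by rewrite xE yE.
by rewrite -xE (disjointFr dXY xX) in y'Y.
Qed.

(** Union bound over a type and two vertex sets, [2 * 4 ^ n] choices; each fixes at least [m * m]
    potential edges to be all present or all absent. *)
Lemma gnp_pure_bound (m : nat) (t : R) : (0 < m)%N -> (20 * m <= n)%N ->
  p <= t -> 1 - p <= t -> t <= 1 ->
  gnp_prob p (@even_non_decomposable n) <= 2 * 4 ^+ n * t ^+ (m * m).
Proof.
move=> m0 mn pt qt t1.
have t0 : 0 <= t by apply: le_trans pt.
apply: le_trans (@gnp_union_bound (bool * {set 'I_n} * {set 'I_n})%type
  (fun w => [&& (m <= #|w.1.2|)%N, (m <= #|w.2|)%N & [disjoint w.1.2 & w.2]])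
  (fun w E => if w.1.1 then cross w.1.2 w.2 \subset E
              else [disjoint cross w.1.2 w.2 & E]) _ _) _.
  move=> E gE [evE ndE].
  have [//|[b [X [Y [mX mY dXY pXY]]]]] := dec_or_pure_pair gE m0 mn evE.
  exists (b, X, Y) => /=; first by rewrite mX mY dXY.
  case: b pXY => pXY.
    by apply/subsetP=> _ /imsetP[[x y] /setXP[/= xX yY] ->]; apply: pXY.
  rewrite -setI_eq0; apply/eqP/setP=> e; rewrite !inE; apply/negP => /andP[].
  move=> /imsetP[[x y] /setXP[/= xX yY] ->]; apply/negP/negbT; exact: pXY.
apply: le_trans (_ : \sum_(w : bool * {set 'I_n} * {set 'I_n}) t ^+ (m * m) <= _).
  rewrite [leRHS](bigID (fun w : bool * {set 'I_n} * {set 'I_n} =>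
    [&& (m <= #|w.1.2|)%N, (m <= #|w.2|)%N & [disjoint w.1.2 & w.2]])) /=.
  rewrite -[leLHS]addr0; apply: lerD; last by apply: sumr_ge0 => *; apply: exprn_ge0.
  apply: ler_sum => -[[b X] Y] /= /and3P[mX mY dXY].
  have le_pow s : 0 <= s -> s <= t -> s ^+ #|cross X Y| <= t ^+ (m * m).
    move=> s0 st; rewrite card_cross //.
    apply: le_trans (_ : t ^+ (#|X| * #|Y|) <= _); first by rewrite lerXn2r ?nnegrE.
    by apply: ler_wiXn2l => //; apply: leq_mul.
  case: b; first by rewrite gnp_contains ?cross_pairs ?le_pow.
  by rewrite gnp_avoids ?cross_pairs ?le_pow // subr_ge0.
rewrite sumr_const -[leLHS]mulr_natl ler_wpM2r ?exprn_ge0 //.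
have card_sets : #|{set 'I_n}| = (2 ^ n)%N.
  by rewrite -cardsT -powersetT card_powerset cardsT card_ord.
by rewrite !card_prod card_bool card_sets -mulnA -expnMn natrM natrX.
Qed.
End Gnp.

(** * Numerical estimates and the final bound *)

(** Multiplied by [c], the left side is at most [8 * n ^ 2], and [n <= 25 * m] bounds this by
    [8 * 625 = 5000] times [m * m]. *)
Lemma square_dominates (c k m n : nat) : (5000 <= c)%N -> (c <= n)%N ->
  (k * c <= n + c)%N -> (n <= 25 * m)%N -> (k * (4 * n) <= m * m)%N.
Proof.
move=> c5 cn kc nm.
have kc2 : (k * c <= 2 * n)%N by lia.
rewrite -(@leq_pmul2r c); last by lia.
apply: (@leq_trans (2 * n * (4 * n))); first by rewrite mulnAC leq_mul2r kc2 orbT.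
apply: (@leq_trans (5000 * (m * m))); last by rewrite mulnC leq_mul2l c5 orbT.
have := leq_mul nm nm; lia.
Qed.

Theorem mainTheorem2 (R : realType) :
  exists C : R, forall (n : nat) (p : R),
    (1 <= n)%N -> 0 <= p -> p <= 1 - (10 ^+ 5) / n%:R ->
    gnp_prob p (@even_non_decomposable n) <= C / (n%:R ^+ 2).
Proof.
have [c [cE c5]] : exists c : nat, c%:R = 10 ^+ 5 :> R /\ (5000 <= c)%N.
  by exists (10 ^ 5)%N; rewrite natrX; split=> //; vm_compute.
(* The sixth power pays for the sparse case, the 2 for the dense one. *)
exists (c%:R ^+ 6 + 2) => n p n1 p0; rewrite -cE; set x := c%:R / n%:R => px.
have n0 : 0 < n%:R :> R by rewrite ltr0n.
have x0 : 0 <= x by rewrite divr_ge0.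
have x1 : x <= 1 by lra.
have cn : (c <= n)%N by rewrite -(ler_nat R) -[leRHS]mul1r -ler_pdivrMr.
have p1 : p <= 1 by lra.
have C0 : 0 <= c%:R ^+ 6 :> R by rewrite exprn_ge0.
rewrite ler_pdivlMr ?exprn_gt0 //.
(* In the sparse case [n ^ 4 * x ^ 6 * n ^ 2] equals [(n * x) ^ 6 = c ^ 6]. *)
have [le_px|lt_xp] := lerP p x.
  apply: le_trans (_ : n%:R ^+ 4 * x ^+ 6 * n%:R ^+ 2 <= _).
    rewrite ler_wpM2r ?exprn_ge0 //; apply: le_trans (gnp_K4_bound n p0 p1) _.
    by rewrite ler_wpM2l ?exprn_ge0 // lerXn2r ?nnegrE.
  rewrite mulrAC -exprD -exprMn mulrC divfK ?gt_eqF //; lra.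
(* Here [t] bounds both [p] and [1 - p], and [k] is chosen so that [k * x >= 1] while
   [k * c <= n + c]. *)
pose m := (n %/ 20)%N; pose k := (n %/ c).+1; pose t := 1 - x.
have m0 : (0 < m)%N by rewrite divn_gt0 //; lia.
have mn : (20 * m <= n)%N by rewrite mulnC leq_divM.
have n25 : (n <= 25 * m)%N.
  by have := divn_eq n 20; have := ltn_pmod n (isT : 0 < 20)%N; rewrite /m; lia.
have c0 : (0 < c)%N by lia.
have kc : (k * c <= n + c)%N by rewrite /k mulSn addnC leq_add2r leq_divM.
have kn : (n <= k * c)%N by rewrite ltnW // ltn_ceil.
have t0 : 0 <= t by rewrite /t; lra.
have t1 : t <= 1 by rewrite /t; lra.
(* By Bernoulli [(1 + x) ^ k >= 1 + k * x >= 2], while [(1 - x) * (1 + x) <= 1]. *)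
have half : t ^+ k * 2 <= 1.
  apply: le_trans (_ : t ^+ k * (1 + x) ^+ k <= _).
    rewrite ler_wpM2l ?exprn_ge0 //.
    apply: le_trans (_ : 1 + x *+ k <= _).
      rewrite -[x *+ k]mulr_natr /x mulrAC lerD2l ler_pdivlMr // mul1r -natrM ler_nat.
      by rewrite mulnC.
    elim: (k) => [|j IHj]; first by rewrite mulr0n addr0.
    rewrite exprS; apply: le_trans (_ : (1 + x) * (1 + x *+ j) <= _); last first.
      by rewrite ler_wpM2l //; lra.
    have : 0 <= x * (x *+ j) by rewrite mulr_ge0 // mulrn_wge0.
    rewrite mulrS; lra.
  rewrite -exprMn exprn_ile1 //; rewrite /t; nra.
apply: le_trans (_ : 2 * 4 ^+ n * t ^+ (m * m) * n%:R ^+ 2 <= _).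
  rewrite ler_wpM2r ?exprn_ge0 //.
  by apply: (gnp_pure_bound p0 p1) => //; rewrite /t; lra.
have tk : t ^+ (m * m) <= (t ^+ k) ^+ (4 * n).
  by rewrite -exprM ler_wiXn2l // (square_dominates c5).
have n2 : n%:R ^+ 2 <= 4 ^+ n :> R.
  by rewrite -!natrX ler_nat -[4%N]/(2 ^ 2)%N -expnM mulnC expnM leq_exp2r // ltnW // ltn_expl.
(* One factor [4 ^ n] counts the pairs of sets, the other bounds [n ^ 2]; together they are
   [2 ^ (4 * n)], which [half] cancels. *)
have small : 4 ^+ n * (t ^+ k) ^+ (4 * n) * 4 ^+ n <= 1.
  apply: le_trans (_ : (t ^+ k * 2) ^+ (4 * n) <= _); last first.
    by rewrite exprn_ile1 // mulr_ge0 ?exprn_ge0.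
  rewrite exprMn mulrAC mulrC ler_wpM2l ?exprn_ge0 //.
  have -> : 4 = 2 ^+ 2 :> R by rewrite -natrX.
  by rewrite -exprM -exprD ler_weXn2l ?ler1n //; lia.
apply: le_trans (_ : 2 * (4 ^+ n * (t ^+ k) ^+ (4 * n) * 4 ^+ n) <= _); last by lra.
rewrite -!mulrA !ler_wpM2l ?exprn_ge0 //.
by rewrite ler_pM ?exprn_ge0.
Qed.
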